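(* For every integer $h\ge 2$, $$L_m(\mathbf{BRecMAJ}_3^h) \geq 4^h + \frac{13}{36}\left(\frac{8}{3}\right)^h.$$
   Context: $\mathbf{MAJ}_3$ is the 3-bit majority function (outputs $1$ iff at least two inputs are $1$). The balanced recursive ternary majority functions $\mathbf{BRecMAJ}_3^h:\{0,1\}^{3^h}\to\{0,1\}$ are defined by $\mathbf{BRecMAJ}_3^1=\mathbf{MAJ}_3$ and, for $h\ge2$, $\mathbf{BRecMAJ}_3^h(x_1,\dots,x_{3^h}) = \mathbf{MAJ}_3(\mathbf{BRecMAJ}_3^{h-1}(x_1,\dots,x_{3^{h-1}}), \mathbf{BRecMAJ}_3^{h-1}(x_{3^{h-1}+1},\dots,x_{2\cdot 3^{h-1}}), \mathbf{BRecMAJ}_3^{h-1}(x_{2\cdot3^{h-1}+1},\dots,x_{3^h}))$. A monotone formula is a binary tree whose leaves are labeled by (unnegated) variables and whose internal nodes are labeled by $\wedge$ or $\vee$; its size is its number of leaves. $L_m(f)$ is the minimum size of a monotone formula computing $f$. *)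

(* Defs.v *)
From mathcomp Require Import all_boot all_order all_algebra.
From mathcomp Require Import boolp.
Set Implicit Arguments. Unset Strict Implicit. Unset Printing Implicit Defensive.

(* Leaves are unnegated variables only: there are no constant leaves. *)
Inductive mformula (n : nat) : Type :=
| MVar of 'I_n
| MAnd of mformula n & mformula n
| MOr of mformula n & mformula n.

Fixpoint meval n (phi : mformula n) (x : n.-tuple bool) : bool :=
  match phi with
  | MVar i => tnth x i
  | MAnd a b => meval a x && meval b x
  | MOr a b => meval a x || meval b x
  end.

Fixpoint msize n (phi : mformula n) : nat :=
  match phi with
  | MVar _ => 1
  | MAnd a b => msize a + msize b
  | MOr a b => msize a + msize b
  end.

Definition computes n (phi : mformula n) (f : n.-tuple bool -> bool) : Prop :=
  forall x, meval phi x = f x.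

Definition has_mformula_of_size n (f : n.-tuple bool -> bool) (s : nat) : bool :=
  `[< exists phi : mformula n, computes phi f /\ msize phi = s >].

(* When no monotone formula computes f, the value is the junk value 0, which is
   never the size of a formula; a positive lower bound on Lm f therefore also
   asserts that f has a monotone formula. *)
Definition Lm n (f : n.-tuple bool -> bool) : nat :=
  match pselect (exists s, has_mformula_of_size f s) with
  | left ex => ex_minn ex
  | right _ => 0
  end.

Lemma Lm_min n (f : n.-tuple bool -> bool) (phi : mformula n) :
  computes phi f ->
  (exists psi : mformula n, computes psi f /\ msize psi = Lm f)
  /\ (forall psi : mformula n, computes psi f -> Lm f <= msize psi).
Proof.
move=> phif; rewrite /Lm; case: pselect => [ex|]; last first.
  by case; exists (msize phi); apply/asboolP; exists phi.
case: ex_minnP => m /asboolP[psi psiP] mmin; split; first by exists psi.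
by move=> chi chif; apply: mmin; apply/asboolP; exists chi.
Qed.

Definition maj3 (a b c : bool) : bool := 2 <= a + b + c.

Lemma block_idx_subproof h (k : 'I_3) (j : 'I_(3 ^ h)) :
  k * 3 ^ h + j < 3 ^ h.+1.
Proof.
rewrite expnS; apply: (@leq_trans (k.+1 * 3 ^ h)).
  by rewrite mulSn addnC ltn_add2r.
by rewrite leq_mul2r ltn_ord orbT.
Qed.

Definition block_idx h (k : 'I_3) (j : 'I_(3 ^ h)) : 'I_(3 ^ h.+1) :=
  Ordinal (block_idx_subproof k j).

(* The k-th (k = 0, 1, 2) of the three consecutive blocks of length 3 ^ h. *)
Definition block h (k : 'I_3) (x : (3 ^ h.+1).-tuple bool) :
    (3 ^ h).-tuple bool :=
  [tuple tnth x (block_idx k j) | j < 3 ^ h].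

(* The recursion starts from the one-variable function at h = 0, so that
   h = 1 gives maj3 (BRecMAJ3_1 below). *)
Fixpoint BRecMAJ3 (h : nat) : (3 ^ h).-tuple bool -> bool :=
  match h return (3 ^ h).-tuple bool -> bool with
  | 0 => fun x => tnth x (ord0 : 'I_1)
  | h'.+1 => fun x => maj3 (BRecMAJ3 (block (inord 0) x))
                           (BRecMAJ3 (block (inord 1) x))
                           (BRecMAJ3 (block (inord 2) x))
  end.

Lemma BRecMAJ3_1 (a b c : bool) :
  @BRecMAJ3 1 [tuple a; b; c] = maj3 a b c.
Proof.
rewrite /= /block !tnth_mktuple !(tnth_nth false) /=.
by rewrite !inordK.
Qed.

(* Main.v *)
(* A monotone formula of size [s] partitions minterms x maxterms into [s]
   rectangles, each one labelled by a variable ("colour") common to all its cells.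
   Call a cell a singleton if its minterm and maxterm meet in one variable, which
   happens with probability [(2/3)^h].  Singleton cells fall into [6^h] types, and
   each type is a rectangle of measure [9^-h].  With [9^-h] as the unit of measure,
   let [K_R] be the measure of the singleton cells in the rectangle [R].  Then
   [sum K_R = 6^h], and [K_R^2 <= |R|] gives Khrapchenko's bound [4^h] by
   Cauchy-Schwarz.

   We gain by showing [sum K_R^2 <= 9^h - w_h].  When the minterm and the maxterm
   omit the same child of a node, the remaining cells are singletons below both
   common children, hence have two admissible colours, one through each child.
   A rectangle contributes to [K_R^2] through such diagonal cells only by the
   product [d d'] of its measures on two of the three diagonal blocks.  If [x],
   [y], [z] are the fractions of the three blocks given to one of their two colours,
   then [x (1 - z) + y (1 - x) + z (1 - y) <= 1]: a third of this area is lost.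
   Summing over all nodes gives [w_(h+1) = 6 w_h + kappa_h 6^h] and
   [s >= 36^h / (9^h - w_h)]; for [h = 2] one also uses that [s] is an integer. *)
Require Import Defs.
From mathcomp Require Import all_boot all_order all_algebra.
From mathcomp Require Import ring lra.
Set Implicit Arguments. Unset Strict Implicit. Unset Printing Implicit Defensive.
Import Order.TTheory GRing.Theory Num.Theory.
Local Open Scope ring_scope.

(** * Averages over finite types and resampling of one coordinate *)

Definition avg (T : finType) (f : T -> rat) : rat := (\sum_x f x) / #|T|%:R.

Lemma eq_avg (T : finType) (f g : T -> rat) : f =1 g -> avg f = avg g.
Proof. by move=> fg; rewrite /avg (eq_bigr g). Qed.

Lemma natrX_ge0 (n h : nat) : 0 <= n%:R ^+ h :> rat.
Proof. by rewrite -natrX ler0n. Qed.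

Lemma two_thirds01 : 0 <= 2 / 3 :> rat /\ 2 / 3 <= 1 :> rat.
Proof. by split; lra. Qed.

Lemma twothirdsX_ge0 h : 0 <= (2 / 3) ^+ h :> rat.
Proof. by case: two_thirds01 => r0 _; exact: exprn_ge0. Qed.

Lemma twothirdsX_le1 h : (2 / 3) ^+ h <= 1 :> rat.
Proof. by case: two_thirds01 => r0 r1; exact: exprn_ile1. Qed.

Lemma avgD (T : finType) (f g : T -> rat) :
  avg (fun x => f x + g x) = avg f + avg g.
Proof. by rewrite /avg big_split mulrDl. Qed.

Lemma avgZ (T : finType) (a : rat) (f : T -> rat) :
  avg (fun x => a * f x) = a * avg f.
Proof. by rewrite /avg -mulr_sumr mulrA. Qed.

Lemma avgB (T : finType) (f g : T -> rat) :
  avg (fun x => f x - g x) = avg f - avg g.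
Proof. by rewrite /avg sumrB mulrBl. Qed.

Lemma avg_sum (I : Type) (r : seq I) (P : pred I) (T : finType)
    (f : I -> T -> rat) :
  avg (fun x => \sum_(i <- r | P i) f i x) = \sum_(i <- r | P i) avg (f i).
Proof. by rewrite /avg exchange_big mulr_suml. Qed.

Lemma avg_cst (T : finType) (a : rat) : (0 < #|T|)%N -> avg (fun _ : T => a) = a.
Proof.
by move=> T0; rewrite /avg sumr_const -[a *+ _]mulr_natr mulfK // pnatr_eq0 -lt0n.
Qed.

Lemma le_avg (T : finType) (f g : T -> rat) :
  (forall x, f x <= g x) -> avg f <= avg g.
Proof. by move=> fg; rewrite /avg ler_wpM2r ?invr_ge0 ?ler0n// ler_sum. Qed.

Lemma avg_ge0 (T : finType) (f : T -> rat) : (forall x, 0 <= f x) -> 0 <= avg f.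
Proof. by move=> f0; rewrite /avg mulr_ge0 ?invr_ge0 ?ler0n// sumr_ge0. Qed.

Lemma avgM (T U : finType) (f : T -> rat) (g : U -> rat) :
  avg f * avg g = avg (fun x => avg (fun y => f x * g y)).
Proof.
transitivity (avg (fun x => avg g * f x)); first by rewrite avgZ mulrC.
by apply: eq_avg => x; rewrite avgZ mulrC.
Qed.

Lemma exchange_avg (T U : finType) (f : T -> U -> rat) :
  avg (fun x => avg (f x)) = avg (fun y => avg (f^~ y)).
Proof.
rewrite /avg -!mulr_suml exchange_big mulrAC.
by rewrite -!mulrA [X in _ * X]mulrC.
Qed.

Lemma avg_pair (T U : finType) (f : T * U -> rat) :
  avg f = avg (fun x => avg (fun y => f (x, y))).
Proof.
rewrite /avg card_prod natrM invfM -mulr_suml pair_bigA /=.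
by rewrite mulrA mulrAC; congr (_ / _ / _); apply: eq_bigr; case.
Qed.

Lemma sqr_avg (T : finType) (f : T -> rat) :
  avg f ^+ 2 <= avg (fun x => f x ^+ 2).
Proof.
have [T0|T0] := posnP #|T|; first by rewrite /avg T0 invr0 !mulr0 expr0n.
set m := avg f.
have : 0 <= avg (fun x => (f x - m) ^+ 2) by apply: avg_ge0 => x; exact: sqr_ge0.
rewrite (@eq_avg _ _ (fun x => (f x ^+ 2 - (m *+ 2) * f x) + m ^+ 2)); last first.
  by move=> x; ring.
rewrite avgD avgB avgZ avg_cst // -/m; lra.
Qed.

Definition update (T : Type) (g : {ffun 'I_3 -> T}) (c : 'I_3) (x : T) :
  {ffun 'I_3 -> T} := [ffun k => if k == c then x else g k].

Lemma updateE T (g : {ffun 'I_3 -> T}) c x : update g c x c = x.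
Proof. by rewrite ffunE eqxx. Qed.

Lemma update_neq T (g : {ffun 'I_3 -> T}) c x k : k != c -> update g c x k = g k.
Proof. by rewrite ffunE => /negPf->. Qed.

(** Swapping [g c] with the fresh value [x] is an involution on pairs [(g, x)], so resampling one
    coordinate preserves the uniform measure. *)
Lemma avg_update (T : finType) (c : 'I_3) (f : {ffun 'I_3 -> T} -> rat) :
  avg f = avg (fun g => avg (fun x => f (update g c x))).
Proof.
have [T0|T0] := posnP #|T|.
  rewrite /avg card_ffun T0 card_ord exp0n// invr0 mulr0.
  by under eq_bigr do rewrite mulr0; rewrite big1 ?mul0r.
have class_meas : involutive
    (fun p : {ffun 'I_3 -> T} * T => (update p.1 c p.2, p.1 c)).
  move=> [g x] /=; rewrite updateE; congr (_, _).
  by apply/ffunP => k; rewrite !ffunE; case: eqP => [->|].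
transitivity (avg (fun p : {ffun 'I_3 -> T} * T => f p.1)).
  by rewrite avg_pair; apply: eq_avg => g; rewrite /= avg_cst.
rewrite -[RHS](avg_pair (fun p : {ffun 'I_3 -> T} * T => f (update p.1 c p.2))).
rewrite /avg; congr (_ / _).
by rewrite (reindex_inj (inv_inj class_meas)).
Qed.

(** * Minterms, maxterms and types of singleton cells *)

(* Minterms: at each node one child is omitted.  By self-duality the same type
   also describes maxterms.  The omitted child carries an irrelevant dummy
   subterm, so that the uniform measure on [mterm h.+1] is a product measure. *)
Fixpoint mterm (h : nat) : finType :=
  if h is h'.+1 then ('I_3 * {ffun 'I_3 -> mterm h'})%type : finType else unit.

Fixpoint color (h : nat) : finType :=
  if h is h'.+1 then ('I_3 * color h')%type : finType else unit.

(* Types of singleton cells: a path of common children [c], where the boolean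
   tells which of the two other children the minterm omits; the maxterm omits
   the remaining one. *)
Fixpoint stype (h : nat) : finType :=
  if h is h'.+1 then ('I_3 * bool * stype h')%type : finType else unit.

Fixpoint in_term (h : nat) : mterm h -> color h -> bool :=
  match h with
  | 0 => fun _ _ => true
  | h'.+1 => fun P i => (i.1 != P.1) && in_term (P.2 i.1) i.2
  end.

Definition other (c : 'I_3) (o : bool) : 'I_3 := if o then c + 1 else c + 2.

(* [b = false] is the minterm side, [b = true] the maxterm side. *)
Fixpoint in_class (b : bool) (h : nat) : stype h -> mterm h -> bool :=
  match h with
  | 0 => fun _ _ => true
  | h'.+1 => fun u P => (P.1 == other u.1.1 (u.1.2 (+) b)) && in_class b u.2 (P.2 u.1.1)
  end.

Fixpoint stype_color (h : nat) : stype h -> color h :=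
  match h with
  | 0 => fun _ => tt
  | h'.+1 => fun u => (u.1.1, stype_color u.2)
  end.

Lemma mterm_gt0 h : (0 < #|mterm h|)%N.
Proof.
elim: h => [|h IH] /=; first by rewrite card_unit.
by rewrite card_prod card_ffun !card_ord muln_gt0 expn_gt0 IH.
Qed.

Lemma fmterm_gt0 h : (0 < #|{ffun 'I_3 -> mterm h}|)%N.
Proof. by rewrite card_ffun card_ord expn_gt0 mterm_gt0. Qed.

Lemma card_stype h : #|stype h| = (6 ^ h)%N.
Proof.
elim: h => [|h IH] /=; first by rewrite card_unit.
by rewrite !card_prod IH card_ord card_bool expnS.
Qed.

Lemma other_third (c k : 'I_3) (o : bool) : k != other c o -> k != other c (~~ o) -> k = c.
Proof.
move=> h1 h2; apply/eqP; move: h1 h2.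
by case: o; case: c k => [[|[|[|//]]] ?] [[|[|[|//]]] ?].
Qed.

Lemma other_inj c : injective (other c).
Proof. by case: c => [[|[|[|//]]] ?] [] [] // /(congr1 val). Qed.

Lemma other_neq c o : other c o != c.
Proof. by case: c o => [[|[|[|//]]] ?] []. Qed.

Lemma other_neqC c o : other c o != other c (~~ o).
Proof. by case: c o => [[|[|[|//]]] ?] []. Qed.

(** At each node on the path of [u] the two sides omit the two different children other than the
    path's child, which leaves it as the only common one. *)
Lemma in_class_color h (u : stype h) (P Q : mterm h) (i : color h) :
  in_class false u P -> in_class true u Q -> in_term P i -> in_term Q i -> i = stype_color u.
Proof.
elim: h u P Q i => [|h IH] /=; first by move=> _ _ _ [].
move=> [[c o] u] [a P] [b Q] [k j] /= /andP[/eqP-> uP] /andP[/eqP-> uQ].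
rewrite addbF addbT => /andP[ka Pj] /andP[kb Qj].
have kc := other_third ka kb; rewrite kc in Pj Qj *.
by congr (_, _); apply: IH uP uQ Pj Qj.
Qed.

(** Along a fixed path the omitted child at each node reveals the boolean of the type. Hence a term
    lies in at most one class per colour. *)
Lemma in_class_inj b h (u v : stype h) (P : mterm h) :
  stype_color u = stype_color v -> in_class b u P -> in_class b v P -> u = v.
Proof.
elim: h u v P => [|h IH] /=; first by move=> [] [].
move=> [[c o] u] [[d p] v] [a P] /= [<- uv] /andP[/eqP-> uP] /andP[/eqP/other_inj op vP].
by rewrite (IH _ _ _ uv uP vP) (addIb op).
Qed.

Lemma in_class_in_term h (u : stype h) (P : mterm h) b :
  in_class b u P -> in_term P (stype_color u).
Proof.
elim: h u P => [//|h IH] [[c o] u] [a P] /= /andP[/eqP-> uP].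
by rewrite eq_sym other_neq IH.
Qed.

Lemma singleton_stype_uniq h (u v : stype h) (P Q : mterm h) :
  in_class false u P -> in_class true u Q -> in_class false v P -> in_class true v Q -> u = v.
Proof.
move=> uP uQ vP vQ; apply: (in_class_inj _ uP vP); apply: (@in_class_color _ v P Q) => //.
  exact: in_class_in_term uP.
exact: in_class_in_term uQ.
Qed.

Lemma avg_eq_op (T : finType) (a : T) (f : T -> rat) :
  avg (fun x => (x == a)%:R * f x) = f a / #|T|%:R.
Proof.
rewrite /avg (bigD1 a)//= eqxx mul1r big1 ?addr0// => x /negPf->.
by rewrite mul0r.
Qed.

Lemma avg_mterm b h (c : 'I_3) o (u : stype h) (f : mterm h.+1 -> rat) :
  avg (fun P => f P * (@in_class b h.+1 (c, o, u) P)%:R) =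
  3^-1 * avg (fun g => f (other c (o (+) b), g) * (in_class b u (g c))%:R).
Proof.
rewrite avg_pair /= exchange_avg -avgZ; apply: eq_avg => g.
rewrite (@eq_avg _ _ (fun x => (x == other c (o (+) b))%:R * (f (x, g) * (in_class b u (g c))%:R))).
  by rewrite avg_eq_op card_ord mulrC.
by move=> x; rewrite -mulnb natrM mulrCA.
Qed.

Lemma avg_in_class b h (u : stype h) :
  avg (fun P => (in_class b u P)%:R) = 3^-1 ^+ h.
Proof.
elim: h u => [|h IH]; first by rewrite /= avg_cst ?card_unit.
move=> [[c o] u].
have := avg_mterm b c o u (fun=> 1).
under eq_avg do rewrite mul1r.
move=> ->; under eq_avg do rewrite mul1r.
rewrite (avg_update c); under eq_avg do under eq_avg do rewrite updateE.
by rewrite avg_cst ?fmterm_gt0// IH exprS.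
Qed.

(** * Singleton measure of a rectangle and its splitting at the root *)

(** The factor [3 ^+ h] makes this the conditional probability of [f] given the class [u], so that
    [sing_meas] is in units of [9^-h]. *)
Definition class_meas b h (f : mterm h -> bool) (u : stype h) : rat :=
  3 ^+ h * avg (fun P => (f P)%:R * (in_class b u P)%:R).

Definition sing_meas h (f g : mterm h -> bool) : rat :=
  \sum_u class_meas false f u * class_meas true g u.

Lemma indic_ge0 (b : bool) : 0 <= b%:R :> rat.
Proof. exact: ler0n. Qed.

Lemma indic_le1 (b : bool) : b%:R <= 1 :> rat.
Proof. by case: b; rewrite ?lexx ?ler01. Qed.

Lemma class_meas_ge0 b h f (u : stype h) : 0 <= class_meas b f u.
Proof.
rewrite /class_meas mulr_ge0 ?natrX_ge0//; apply: avg_ge0 => P.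
by rewrite mulr_ge0 ?indic_ge0.
Qed.

Lemma class_meas_le1 b h f (u : stype h) : class_meas b f u <= 1.
Proof.
have : class_meas b f u <= 3 ^+ h * avg (fun P => (in_class b u P)%:R).
  rewrite /class_meas ler_wpM2l ?natrX_ge0//; apply: le_avg => P.
  by rewrite ler_piMl ?indic_ge0 ?indic_le1.
by move=> /le_trans->//; rewrite avg_in_class -exprMn divff// expr1n.
Qed.

Definition tiling h (I : finType) (S T : I -> mterm h -> bool) (col : I -> color h) :=
  (forall P Q, \sum_r (S r P)%:R * (T r Q)%:R = 1 :> rat) /\
  (forall r P Q, S r P -> T r Q -> in_term P (col r) && in_term Q (col r)).

Lemma sum_sing_meas h (I : finType) (S T : I -> mterm h -> bool) :
  (forall P Q, \sum_r (S r P)%:R * (T r Q)%:R = 1 :> rat) ->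
  \sum_r sing_meas (S r) (T r) = 6 ^+ h.
Proof.
move=> cov; rewrite exchange_big -[RHS]natrX -card_stype -sum1_card natr_sum.
apply: eq_bigr => u _.
under eq_bigr do rewrite /class_meas mulrACA avgM.
rewrite -mulr_sumr -avg_sum (@eq_avg _ _ (fun x => (in_class false u x)%:R * 3^-1 ^+ h)).
  rewrite (@eq_avg _ _ (fun x => 3^-1 ^+ h * (in_class false u x)%:R)); last first.
    by move=> x; rewrite mulrC.
  by rewrite avgZ avg_in_class mulrACA -exprMn divff// expr1n mulr1.
move=> P; rewrite -avg_sum -(avg_in_class true u) -avgZ; apply: eq_avg => Q.
under eq_bigr do rewrite mulrACA.
by rewrite -mulr_suml cov mul1r.
Qed.

(* As [class_meas], for the terms omitting child [e] at the root and of type [u]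
   at child [c]. *)
Definition slice_meas b h (f : mterm h.+1 -> bool) (e c : 'I_3) (u : stype h) : rat :=
  3 ^+ h * avg (fun g => (f (e, g))%:R * (in_class b u (g c))%:R).

Lemma class_meas_succ b h (f : mterm h.+1 -> bool) c o (u : stype h) :
  @class_meas b h.+1 f (c, o, u) = slice_meas b f (other c (o (+) b)) c u.
Proof.
by rewrite /class_meas /slice_meas (@avg_mterm b h c o u (fun P => (f P)%:R)) exprSr -mulrA mulVKf.
Qed.

Lemma slice_meas_update b h (f : mterm h.+1 -> bool) e c (u : stype h) :
  slice_meas b f e c u = avg (fun g => class_meas b (fun x => f (e, update g c x)) u).
Proof.
rewrite /slice_meas (avg_update c) -avgZ; apply: eq_avg => g; rewrite /class_meas; congr (_ * _).
by apply: eq_avg => x; rewrite updateE.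
Qed.

Lemma slice_meas_ge0 b h (f : mterm h.+1 -> bool) e c (u : stype h) : 0 <= slice_meas b f e c u.
Proof. by rewrite slice_meas_update; apply: avg_ge0 => g; exact: class_meas_ge0. Qed.

Lemma slice_meas_le1 b h (f : mterm h.+1 -> bool) e c (u : stype h) : slice_meas b f e c u <= 1.
Proof.
rewrite slice_meas_update -[leRHS](avg_cst 1 (fmterm_gt0 h)).
by apply: le_avg => g; exact: class_meas_le1.
Qed.

(** One of the six off-diagonal blocks: the two sides omit different children, and [c] is the only
    child left to both. *)
Definition off_meas h (f g : mterm h.+1 -> bool) (c : 'I_3) (o : bool) : rat :=
  \sum_u slice_meas false f (other c o) c u * slice_meas true g (other c (~~ o)) c u.

Lemma sing_meas_succ h (f g : mterm h.+1 -> bool) :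
  sing_meas f g = \sum_c \sum_o off_meas f g c o.
Proof.
rewrite pair_bigA /= /off_meas pair_bigA /=; apply: eq_bigr => -[[c o] u] _ /=.
by rewrite !class_meas_succ addbF addbT.
Qed.

(* Fixing everything outside child [c] leaves a tiling of the game one level
   down, and by Jensen's inequality averaging over the fixed part only
   decreases the squares. *)
Lemma sum_off_meas_sqr h (I : finType) (S T : I -> mterm h.+1 -> bool)
    (col : I -> color h.+1) (B : rat) (c : 'I_3) (o : bool) :
  (forall (S T : I -> mterm h -> bool) (col : I -> color h), tiling S T col ->
     \sum_r sing_meas (S r) (T r) ^+ 2 <= B) ->
  tiling S T col -> \sum_r off_meas (S r) (T r) c o ^+ 2 <= B.
Proof.
move=> IH [cov val].
pose S' g r x := S r (other c o, update g c x).
pose T' g r x := T r (other c (~~ o), update g c x).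
have off_measE r : off_meas (S r) (T r) c o =
    avg (fun g => avg (fun g' => sing_meas (S' g r) (T' g' r))).
  rewrite /off_meas; under eq_bigr do rewrite !slice_meas_update avgM.
  by rewrite -avg_sum; apply: eq_avg => g; rewrite avg_sum.
apply: (@le_trans _ _ (\sum_r avg (fun g => avg (fun g' => sing_meas (S' g r) (T' g' r) ^+ 2)))).
  apply: ler_sum => r _; rewrite off_measE; apply: le_trans (sqr_avg _) _.
  by apply: le_avg => g; exact: sqr_avg.
rewrite -avg_sum -[leRHS](avg_cst B (fmterm_gt0 h)); apply: le_avg => g.
rewrite -avg_sum -[leRHS](avg_cst B (fmterm_gt0 h)); apply: le_avg => g'.
apply: (IH _ _ (fun r => (col r).2)); split=> [P Q|r P Q Sr Tr].
  exact: cov.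
have /andP[/= /andP[k1 P1] /andP[k2 Q1]] := val r _ _ Sr Tr.
have kc := other_third k1 k2.
by move: P1 Q1; rewrite kc !updateE => -> ->.
Qed.

Lemma slice_measM h (f g : mterm h.+1 -> bool) e e' c (u v : stype h) :
  slice_meas false f e c u * slice_meas true g e' c v =
  9 ^+ h * avg (fun x => avg (fun y => (f (e, x))%:R * (g (e', y))%:R *
    ((in_class false u (x c))%:R * (in_class true v (y c))%:R))).
Proof.
rewrite /slice_meas mulrACA -exprMn avgM; congr (_ * _).
by apply: eq_avg => x; apply: eq_avg => y; rewrite mulrACA.
Qed.

(** All singleton cells of type [u] below [c] have one common variable, [(c, stype_color u)]; a
    rectangle of another colour contains none of them. *)
Lemma slice_measM_eq0 h (f g : mterm h.+1 -> bool) (i : color h.+1) c o (u : stype h) :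
  (forall P Q, f P -> g Q -> in_term P i && in_term Q i) -> (c, stype_color u) != i ->
  slice_meas false f (other c o) c u * slice_meas true g (other c (~~ o)) c u = 0.
Proof.
move=> val ui.
have -> : slice_meas true g (other c (~~ o)) c u = @class_meas true h.+1 g (c, o, u).
  by rewrite class_meas_succ addbT.
have -> : slice_meas false f (other c o) c u = @class_meas false h.+1 f (c, o, u).
  by rewrite class_meas_succ addbF.
rewrite /class_meas mulrACA avgM /avg big1 ?(mul0r, mulr0)// => P _.
rewrite big1 ?mul0r// => Q _.
case fP: (f P); rewrite ?mul0r//; case gQ: (g Q); rewrite ?mul0r ?mulr0//.
case uP: (in_class _ _ P); rewrite ?mul0r ?mulr0//.
case uQ: (in_class _ _ Q); rewrite ?mul0r ?mulr0//.
have /andP[Pi Qi] := val _ _ fP gQ.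
by rewrite (in_class_color uP uQ Pi Qi) eqxx in ui.
Qed.

(** * Inequalities for [xorr] *)

Lemma affine_ge0 (a b t : rat) : 0 <= t <= 1 -> 0 <= a -> 0 <= a + b -> 0 <= a + b * t.
Proof.
move=> /andP[t0 t1] a0 ab0.
have -> : a + b * t = (1 - t) * a + t * (a + b) by ring.
by rewrite addr_ge0// mulr_ge0// subr_ge0.
Qed.

(** The probability that exactly one of two independent events of probabilities [a] and [b]
    occurs. *)
Definition xorr (a b : rat) := a + b - 2 * a * b.

(** The difference of the two sides is affine in each of [x], [y], [p], [q], so the 16 vertices
    suffice. Where [x] and [y] differ, the right side is [r], [1] or [1 - 2 r + 2 r^2]; where they
    agree, the left side vanishes. *)
Lemma xorr_affine_ge (k r x y p q : rat) :
  0 <= k -> k <= r <= 1 -> k <= 1 - 2 * r + 2 * r ^+ 2 ->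
  0 <= x <= 1 -> 0 <= y <= 1 -> 0 <= p <= 1 -> 0 <= q <= 1 ->
  k * xorr x y <= xorr (r * x + (1 - r) * p) (r * y + (1 - r) * q).
Proof.
move=> k0 /andP[kr r1] kr2 x01 y01 p01 q01; rewrite -subr_ge0 /xorr.
have aff (f : rat -> rat) t : 0 <= t <= 1 -> f t = f 0 + (f 1 - f 0) * t ->
    0 <= f 0 -> 0 <= f 1 -> 0 <= f t.
  by move=> t01 -> f0 f1; apply: affine_ge0 => //; rewrite addrC subrK.
pose F x y p q := r * x + (1 - r) * p + (r * y + (1 - r) * q) -
  2 * (r * x + (1 - r) * p) * (r * y + (1 - r) * q) - k * (x + y - 2 * x * y).
rewrite -/(F x y p q).
have r0 : 0 <= r by lra.
have rr : 0 <= r * (1 - r) by rewrite mulr_ge0// subr_ge0.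
apply: (aff (fun x => F x y p q)) => //=; first by rewrite /F; ring.
all: (apply: (aff (fun y => F _ y p q)) => //=; first by rewrite /F; ring).
all: (apply: (aff (fun p => F _ _ p q)) => //=; first by rewrite /F; ring).
all: (apply: (aff (fun q => F _ _ _ q)) => //=; first by rewrite /F; ring).
all: rewrite /F; nra.
Qed.

Lemma xorr_squeeze_ge (k r x y a b : rat) :
  0 <= k -> k <= r <= 1 -> k <= 1 - 2 * r + 2 * r ^+ 2 ->
  0 <= x <= 1 -> 0 <= y <= 1 ->
  r * x <= a <= 1 - r + r * x -> r * y <= b <= 1 - r + r * y ->
  k * xorr x y <= xorr a b.
Proof.
move=> k0 kr1 kr2 x01 y01 ax bx.
have r1 : r <= 1 by case/andP: kr1.
have ex z c : r * z <= c <= 1 - r + r * z ->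
    exists2 p, 0 <= p <= 1 & c = r * z + (1 - r) * p.
  move=> /andP[zc cz]; have [re|rn] := eqVneq r 1.
    (* For [r = 1] the interval for [c] is a point and the quotient below would divide by 0. *)
    by exists 0 => //; rewrite re in zc cz *; lra.
  have r0 : 0 < 1 - r by rewrite subr_gt0 lt_neqAle rn.
  exists ((c - r * z) / (1 - r)).
    by rewrite divr_ge0 ?ler_pdivrMr ?(ltW r0)//=; lra.
  by rewrite mulrCA divff ?gt_eqF// mulr1; ring.
have [p p01 ->] := ex _ _ ax; have [q q01 ->] := ex _ _ bx.
exact: xorr_affine_ge.
Qed.

(** Only the product term of [xorr] is nonlinear, and the product of the sums has extra nonnegative
    cross terms, subtracted on the left. *)
Lemma sum_xorr_ge (I : finType) (P : pred I) (f g : I -> rat) :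
  (forall i, 0 <= f i) -> (forall i, 0 <= g i) ->
  xorr (\sum_(i | P i) f i) (\sum_(i | P i) g i) <= \sum_(i | P i) xorr (f i) (g i).
Proof.
move=> f0 g0; rewrite /xorr sumrB big_split /= lerD2l lerN2.
rewrite -mulrA big_distrlr /=.
under [leLHS]eq_bigr do rewrite -mulrA.
rewrite -mulr_sumr ler_wpM2l//; apply: ler_sum => i Pi.
by rewrite (bigD1 i) //= lerDl sumr_ge0// => j _; rewrite mulr_ge0.
Qed.

Lemma xorr_avg (T U : finType) (f : T -> rat) (g : U -> rat) :
  (0 < #|T|)%N -> (0 < #|U|)%N ->
  xorr (avg f) (avg g) = avg (fun x => avg (fun y => xorr (f x) (g y))).
Proof.
move=> T0 U0; rewrite /xorr -mulrA avgM -avgZ.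
rewrite -[X in X + _ - _](avg_cst _ U0) -[X in _ + X - _](avg_cst _ T0).
rewrite exchange_avg; under eq_avg do rewrite avg_cst//.
rewrite -[X in X + _ - _](avg_cst _ U0) exchange_avg.
rewrite -avgD -avgB; apply: eq_avg => x.
rewrite avg_cst// -avgZ -[X in X + _ - _](avg_cst _ U0) -avgD -avgB.
by apply: eq_avg => y; rewrite mulrA.
Qed.

(** For three independent bits of biases [x], [y], [z], each summand is the probability that two of
    them agree, and some two always agree. *)
Lemma xorr_cycle (x y z : rat) : 0 <= x <= 1 -> 0 <= y <= 1 -> 0 <= z <= 1 ->
  1 <= xorr x (1 - y) + xorr y (1 - z) + xorr z (1 - x).
Proof.
move=> /andP[x0 x1] /andP[y0 y1] /andP[z0 z1]; rewrite /xorr -subr_ge0.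
have -> : x + (1 - y) - 2 * x * (1 - y) + (y + (1 - z) - 2 * y * (1 - z)) +
   (z + (1 - x) - 2 * z * (1 - x)) - 1 =
   2 * (x * y * z + (1 - x) * (1 - y) * (1 - z)) by ring.
by rewrite mulr_ge0// addr_ge0// !mulr_ge0// subr_ge0.
Qed.

Lemma I3_add3 (c : 'I_3) : c + 1 + 2 = c /\ c + 2 + 1 = c.
Proof. by split; apply/val_inj; case: c => [[|[|[|//]]] ?]. Qed.

(* [Y] is evaluated at three independent types, one for each child of the root. *)
Lemma sum_xorr_avg_ge (U : finType) (Y : 'I_3 -> U -> U -> rat) :
  (0 < #|U|)%N -> (forall e u v, 0 <= Y e u v <= 1) ->
  #|U|%:R <= \sum_c \sum_u xorr (avg (Y (c + 1) u)) (avg (fun v => 1 - Y (c + 2) v u)).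
Proof.
move=> U0 Y01.
have m0 : 0 < #|U|%:R :> rat by rewrite ltr0n.
rewrite -[leLHS]mul1r -ler_pdivlMr// mulr_suml.
rewrite (eq_bigr (fun c => avg (fun u => avg (fun v => avg (fun w =>
   xorr (Y (c + 1) u v) (1 - Y (c + 2) w u)))))); last first.
  by move=> c _; apply: eq_avg => u; rewrite xorr_avg.
rewrite 2!big_ord_recl big_ord1.
set c0 := ord0; set c1 := lift _ _; set c2 := lift _ _.
have -> : c0 + 1 = c1 by apply/val_inj.
have -> : c0 + 2 = c2 by apply/val_inj.
have -> : c1 + 1 = c2 by apply/val_inj.
have -> : c1 + 2 = c0 by apply/val_inj.
have -> : c2 + 1 = c0 by apply/val_inj.
have -> : c2 + 2 = c1 by apply/val_inj.
(* The averaged types are reordered so that in all three terms [u], [v], [w] are the types at the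
   children 0, 1, 2. *)
rewrite [X in _ <= _ + (X + _)](_ : _ = avg (fun u => avg (fun w => avg (fun v =>
   xorr (Y c2 v u) (1 - Y c0 w v))))); last first.
  by rewrite exchange_avg; apply: eq_avg => u; rewrite exchange_avg.
rewrite [X in _ <= _ + (_ + X)](_ : _ = avg (fun u => avg (fun w => avg (fun v =>
   xorr (Y c0 w v) (1 - Y c1 u w))))); last first.
  under eq_avg do rewrite exchange_avg.
  by rewrite exchange_avg.
rewrite -!avgD -[leLHS](avg_cst _ U0); apply: le_avg => u.
rewrite -!avgD -[leLHS](avg_cst _ U0); apply: le_avg => w.
rewrite -!avgD -[leLHS](avg_cst _ U0); apply: le_avg => v.
by rewrite addrA; apply: xorr_cycle.
Qed.

(** * Diagonal blocks and the cross terms of the square *)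

Lemma sum_indic_le1 (I : finType) (p : pred I) :
  (forall i j, p i -> p j -> i = j) -> \sum_i (p i)%:R <= 1 :> rat.
Proof.
move=> p1; rewrite -natr_sum -big_mkcond sum1_card -[leRHS]/(1%:R) ler_nat.
by apply/card_le1_eqP => i j pi pj; exact/p1.
Qed.

Lemma sum_in_class_le1 b h (u : pred (stype h)) (j : color h) (P : mterm h) :
  (forall v, u v -> stype_color v = j) -> \sum_(v | u v) (in_class b v P)%:R <= 1 :> rat.
Proof.
move=> uj; rewrite big_mkcond /=.
rewrite (eq_bigr (fun v => (u v && in_class b v P)%:R)) => [|v _]; last by case: (u v).
apply: sum_indic_le1 => v w /andP[uv vP] /andP[uw wP].
by apply: (in_class_inj _ vP wP); rewrite (uj v) ?(uj w).
Qed.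

Lemma sum_singleton_le1 h (P Q : mterm h) :
  \sum_u (in_class false u P)%:R * (in_class true u Q)%:R <= 1 :> rat.
Proof.
under eq_bigr do rewrite -natrM mulnb.
apply: sum_indic_le1 => u v /andP[uP uQ] /andP[vP vQ].
exact: singleton_stype_uniq uP uQ vP vQ.
Qed.

Lemma avg_coord h (c : 'I_3) (F : mterm h -> rat) :
  avg (fun g : {ffun 'I_3 -> mterm h} => F (g c)) = avg F.
Proof.
rewrite (avg_update c); under eq_avg do under eq_avg do rewrite updateE.
by rewrite avg_cst ?fmterm_gt0.
Qed.

Lemma avg_in_class2 b h c c' (u v : stype h) : c != c' ->
  avg (fun g : {ffun 'I_3 -> mterm h} => (in_class b u (g c))%:R * (in_class b v (g c'))%:R) =
  9^-1 ^+ h.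
Proof.
move=> cc; rewrite (avg_update c).
have cc' : c' != c by rewrite eq_sym.
under eq_avg do under eq_avg do rewrite updateE (update_neq _ _ cc') mulrC.
under eq_avg do rewrite avgZ avg_in_class mulrC.
rewrite avgZ (avg_update c'); under eq_avg do under eq_avg do rewrite updateE.
by rewrite avg_cst ?fmterm_gt0// avg_in_class -exprMn.
Qed.

(** Both sides omit the same child [other c o], so their types at the common child [c] may differ:
    [u] for the minterm, [v] for the maxterm. *)
Definition diag_meas h (f g : mterm h.+1 -> bool) (c : 'I_3) (o : bool) (u v : stype h) : rat :=
  slice_meas false f (other c o) c u * slice_meas true g (other c o) c v.

Lemma diag_meas_ge0 h (f g : mterm h.+1 -> bool) c o u v : 0 <= diag_meas f g c o u v.
Proof. by rewrite mulr_ge0// slice_meas_ge0. Qed.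

Lemma diag_meas_le1 h (f g : mterm h.+1 -> bool) c o u v : diag_meas f g c o u v <= 1.
Proof. by rewrite mulr_ile1 ?slice_meas_ge0 ?slice_meas_le1. Qed.

Lemma off_meas_color h (f g : mterm h.+1 -> bool) (i : color h.+1) c o :
  (forall P Q, f P -> g Q -> in_term P i && in_term Q i) ->
  off_meas f g c o = \sum_(u : stype h | (c, stype_color u) == i)
     slice_meas false f (other c o) c u * slice_meas true g (other c (~~ o)) c u.
Proof.
move=> val; rewrite [RHS]big_mkcond; apply: eq_bigr => u _.
by case: ifPn => // ui; apply: slice_measM_eq0 ui.
Qed.

(* For a rectangle the product of its measures on two off-diagonal cells is the
   product of its measures on the two opposite, diagonal cells; for these,
   [2 d d' <= d + d'] up to [xorr d d'], which is kept when the types agree. *)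
Lemma off_meas_cross h (f g : mterm h.+1 -> bool) (i : color h.+1) c :
  (forall P Q, f P -> g Q -> in_term P i && in_term Q i) ->
  2 * (off_meas f g c true * off_meas f g c false) <=
  \sum_o \sum_(u : stype h | (c, stype_color u) == i)
     \sum_(v : stype h | (c, stype_color v) == i) diag_meas f g c o u v
  - \sum_(u : stype h | (c, stype_color u) == i)
     xorr (diag_meas f g c true u u) (diag_meas f g c false u u).
Proof.
move=> val; rewrite !(off_meas_color _ _ val) big_distrlr mulr_sumr big_bool /=.
(* Exchanging [u] and [v] in the block [o = false] pairs the diagonal cells whose product is the
   product of the two off-diagonal ones. *)
rewrite [X in _ + X - _]exchange_big -big_split -sumrB /=; apply: ler_sum => u ui.
rewrite mulr_sumr -big_split /= (bigD1 u)//= [X in _ <= X - _](bigD1 u)//=.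
rewrite addrAC; apply: lerD.
  by rewrite /xorr /diag_meas; lra.
apply: ler_sum => v _.
set d := diag_meas _ _ _ true _ _; set d' := diag_meas _ _ _ false _ _.
rewrite [X in 2 * X](_ : _ = d * d'); last by rewrite /d /d' /diag_meas /=; ring.
have [d0 d1] : 0 <= d /\ d <= 1 by rewrite diag_meas_ge0 diag_meas_le1.
have [d'0 d'1] : 0 <= d' /\ d' <= 1 by rewrite diag_meas_ge0 diag_meas_le1.
nra.
Qed.

Definition area h (f g : mterm h.+1 -> bool) (e : 'I_3) : rat :=
  avg (fun x => (f (e, x))%:R) * avg (fun y => (g (e, y))%:R).

Lemma area_ge0 h (f g : mterm h.+1 -> bool) e : 0 <= area f g e.
Proof. by rewrite mulr_ge0//; apply: avg_ge0 => x; exact: indic_ge0. Qed.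

Lemma sum_slice_meas b h (f : mterm h.+1 -> bool) (i : color h.+1) e c :
  \sum_(u : stype h | (c, stype_color u) == i) slice_meas b f e c u <=
  3 ^+ h * avg (fun x => (f (e, x))%:R).
Proof.
rewrite /slice_meas -mulr_sumr -avg_sum ler_wpM2l ?natrX_ge0//; apply: le_avg => x.
rewrite -mulr_sumr ler_piMr ?indic_ge0//.
by apply: (@sum_in_class_le1 _ _ _ i.2) => u /eqP<-.
Qed.

Lemma sum_other (k : 'I_3) (F : 'I_3 -> rat) : (forall e, 0 <= F e) ->
  \sum_o F (other k o) <= \sum_e F e.
Proof.
move=> F0; rewrite big_bool (bigD1 (other k true))//= lerD2l.
rewrite (bigD1 (other k false)) ?lerDl ?sumr_ge0//=.
exact: (other_neqC k false).
Qed.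

Lemma sum_diag_meas h (f g : mterm h.+1 -> bool) (i : color h.+1) :
  \sum_c \sum_o \sum_(u : stype h | (c, stype_color u) == i)
     \sum_(v : stype h | (c, stype_color v) == i) diag_meas f g c o u v
  <= 9 ^+ h * \sum_e area f g e.
Proof.
(* Only the child through which the colour passes contributes, and it meets just two diagonal
   blocks. *)
rewrite (bigD1 i.1)//= [X in _ + X]big1 ?addr0; last first.
  move=> c ci; rewrite big1// => o _; rewrite big1// => u.
  by move=> /eqP ui; rewrite -ui eqxx in ci.
apply: (@le_trans _ _ (\sum_o 9 ^+ h * area f g (other i.1 o))); last first.
  rewrite -mulr_sumr ler_wpM2l ?natrX_ge0//; apply: sum_other => e; exact: area_ge0.
apply: ler_sum => o _; rewrite -big_distrlr /=.
have -> : 9 ^+ h = 3 ^+ h * 3 ^+ h :> rat by rewrite -exprMn.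
rewrite /area mulrACA; apply: ler_pM; rewrite ?sum_slice_meas//.
  by apply: sumr_ge0 => u _; exact: slice_meas_ge0.
by apply: sumr_ge0 => u _; exact: slice_meas_ge0.
Qed.

Lemma sum_area h (I : finType) (S T : I -> mterm h.+1 -> bool) e :
  (forall P Q, \sum_r (S r P)%:R * (T r Q)%:R = 1 :> rat) ->
  \sum_r area (S r) (T r) e = 1.
Proof.
move=> cov; under eq_bigr do rewrite /area avgM.
rewrite -avg_sum -[RHS](avg_cst _ (fmterm_gt0 h)); apply: eq_avg => x.
rewrite -avg_sum -[RHS](avg_cst _ (fmterm_gt0 h)); apply: eq_avg => y.
exact: cov.
Qed.

Definition in_cell h c (u : stype h) (x y : {ffun 'I_3 -> mterm h}) : rat :=
  (in_class false u (x c))%:R * (in_class true u (y c))%:R.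

Lemma in_cell_ge0 h c (u : stype h) x y : 0 <= in_cell c u x y.
Proof. by rewrite mulr_ge0 ?indic_ge0. Qed.

Lemma avg_in_cell h c (u : stype h) :
  9 ^+ h * avg (fun x => avg (fun y => in_cell c u x y)) = 1.
Proof.
rewrite -avgM !(avg_coord c (fun P => (in_class _ u P)%:R)) !avg_in_class.
by rewrite -!exprMn -[RHS](expr1n _ h).
Qed.

Lemma avg_in_cell2 h c c' (u v : stype h) : c != c' ->
  81 ^+ h * avg (fun x => avg (fun y => in_cell c u x y * in_cell c' v x y)) = 1.
Proof.
move=> cc; rewrite (@eq_avg _ _ (fun x : {ffun 'I_3 -> mterm h} =>
  avg (fun y : {ffun 'I_3 -> mterm h} =>
    (in_class false u (x c))%:R * (in_class false v (x c'))%:R *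
    ((in_class true u (y c))%:R * (in_class true v (y c'))%:R)))); last first.
  by move=> x; apply: eq_avg => y; rewrite mulrACA.
rewrite -avgM (avg_in_class2 false _ _ cc) (avg_in_class2 true _ _ cc) -2!exprMn.
by rewrite (_ : 81 * (9^-1 * 9^-1) = 1 :> rat) ?expr1n//; lra.
Qed.

(** * The two colours of a diagonal cell *)

Definition cover h (I : finType) (S T : I -> mterm h.+1 -> bool) (col : I -> color h.+1)
    (e : 'I_3) (i : color h.+1) (x y : {ffun 'I_3 -> mterm h}) : rat :=
  \sum_(r | i == col r) (S r (e, x))%:R * (T r (e, y))%:R.

Definition class_cover h (I : finType) (S T : I -> mterm h.+1 -> bool) (col : I -> color h.+1)
    c o (u : stype h) : rat :=
  \sum_(r | (c, stype_color u) == col r) diag_meas (S r) (T r) c o u u.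

(* Conditional probability that a diagonal cell, of type [u] at [c] and [v] at
   the other common child, is covered by a rectangle coloured through [c]. *)
Definition pair_cover h (I : finType) (S T : I -> mterm h.+1 -> bool) (col : I -> color h.+1)
    c o (u v : stype h) : rat :=
  81 ^+ h * avg (fun x => avg (fun y => cover S T col (other c o) (c, stype_color u) x y *
    (in_cell c u x y * in_cell (other c (~~ o)) v x y))).

Lemma cover_ge0 h (I : finType) S T col e i x y : 0 <= @cover h I S T col e i x y.
Proof. by apply: sumr_ge0 => r _; rewrite mulr_ge0 ?indic_ge0. Qed.

Lemma cover_le1 h (I : finType) S T col e i x y :
  tiling S T col -> @cover h I S T col e i x y <= 1.
Proof.
move=> [cov _]; rewrite -(cov (e, x) (e, y)) [leRHS](bigID (fun r => i == col r)) /=.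
by rewrite lerDl sumr_ge0// => r _; rewrite mulr_ge0 ?indic_ge0.
Qed.

Lemma class_coverE h (I : finType) S T col c o (u : stype h) :
  @class_cover h I S T col c o u =
  9 ^+ h * avg (fun x => avg (fun y =>
    cover S T col (other c o) (c, stype_color u) x y * in_cell c u x y)).
Proof.
rewrite /class_cover /diag_meas; under eq_bigr do rewrite slice_measM.
rewrite -mulr_sumr -avg_sum; congr (_ * _); apply: eq_avg => x.
by rewrite -avg_sum; apply: eq_avg => y; rewrite -mulr_suml.
Qed.

Lemma neq_other c o : c != other c o.
Proof. by rewrite eq_sym other_neq. Qed.

Lemma pair_cover01 h (I : finType) S T col c o (u v : stype h) :
  tiling S T col -> 0 <= @pair_cover h I S T col c o u v <= 1.
Proof.
move=> til; apply/andP; split.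
  rewrite mulr_ge0 ?natrX_ge0//; apply: avg_ge0 => x; apply: avg_ge0 => y.
  by rewrite !mulr_ge0 ?cover_ge0 ?in_cell_ge0.
rewrite -(avg_in_cell2 u v (neq_other c (~~ o))) ler_wpM2l ?natrX_ge0//.
apply: le_avg => x; apply: le_avg => y.
by rewrite ler_piMl ?mulr_ge0 ?in_cell_ge0 ?cover_le1.
Qed.

Lemma avg_pair_cover h (I : finType) S T col c o (u : stype h) :
  (2 / 3) ^+ h * avg (@pair_cover h I S T col c o u) =
  9 ^+ h * avg (fun x => avg (fun y => cover S T col (other c o) (c, stype_color u) x y *
    in_cell c u x y * \sum_v in_cell (other c (~~ o)) v x y)).
Proof.
rewrite /pair_cover avgZ mulrA {1}/avg card_stype natrX.
have -> : (2 / 3) ^+ h * 81 ^+ h = 9 ^+ h * 6 ^+ h :> rat.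
  by rewrite -!exprMn.
rewrite -mulrA; congr (_ * _); rewrite mulrC divfK ?expf_neq0//.
rewrite -avg_sum; apply: eq_avg => x; rewrite -avg_sum; apply: eq_avg => y.
by rewrite mulr_sumr; apply: eq_bigr => v _; rewrite mulrA.
Qed.

(** Given a singleton at [c], the other common child is a singleton too with probability [(2/3)^h].
    [pair_cover] governs that part; on the rest the covered fraction is arbitrary. *)
Lemma class_cover_bounds h (I : finType) S T col c o (u : stype h) : tiling S T col ->
  (2 / 3) ^+ h * avg (@pair_cover h I S T col c o u) <= class_cover S T col c o u
    <= 1 - (2 / 3) ^+ h + (2 / 3) ^+ h * avg (@pair_cover h I S T col c o u).
Proof.
move=> til; rewrite avg_pair_cover class_coverE; apply/andP; split.
  rewrite ler_wpM2l ?natrX_ge0//; apply: le_avg => z; apply: le_avg => y.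
  by rewrite ler_piMr ?mulr_ge0 ?cover_ge0 ?in_cell_ge0 ?sum_singleton_le1.
(* There are [6^h] types at the other child, each of measure [9^-h]. *)
have rE : (2 / 3) ^+ h = 9 ^+ h * avg (fun x => avg (fun y =>
    in_cell c u x y * \sum_v in_cell (other c (~~ o)) v x y)).
  transitivity (\sum_(v : stype h) 9^-1 ^+ h : rat).
    by rewrite sumr_const card_stype -[RHS]mulr_natr natrX -exprMn.
  rewrite (eq_avg (g := fun x => \sum_v
    avg (fun y => in_cell c u x y * in_cell (other c (~~ o)) v x y))); last first.
    by move=> z; rewrite -avg_sum; apply: eq_avg => y; rewrite mulr_sumr.
  rewrite avg_sum mulr_sumr; apply: eq_bigr => v _.
  have := avg_in_cell2 u v (neq_other c (~~ o)).
  have -> : 81 ^+ h = 9 ^+ h * 9 ^+ h :> rat by rewrite -exprMn.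
  rewrite -mulrA => /(congr1 (fun z => 9^-1 ^+ h * z)).
  by rewrite mulr1 exprVn mulKf ?expf_neq0.
rewrite -[X in _ <= X - _ + _](avg_in_cell c u) rE -!mulrBr -!mulrDr.
rewrite ler_wpM2l ?natrX_ge0// -!avgB -avgD.
apply: le_avg => z; rewrite -!avgB -avgD; apply: le_avg => y.
set a := cover _ _ _ _ _ _ _; set b := in_cell c u z y; set s := \sum_v _.
have a0 : 0 <= a by exact: cover_ge0.
have a1 : a <= 1 by exact: cover_le1.
have b0 : 0 <= b by exact: in_cell_ge0.
have s1 : s <= 1 by exact: sum_singleton_le1.
rewrite -subr_ge0.
have -> : b - b * s + a * b * s - a * b = (1 - a) * b * (1 - s) by ring.
by rewrite !mulr_ge0// subr_ge0.
Qed.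

(* Such a cell has exactly two admissible colours. *)
Lemma pair_cover_sum h (I : finType) S T col e (u v : stype h) : tiling S T col ->
  @pair_cover h I S T col (e + 2) true u v + pair_cover S T col (e + 1) false v u = 1.
Proof.
move=> [cov val]; rewrite /pair_cover /= -mulrDr.
have e1 : e + 2 + 1 = e by case: (I3_add3 e).
have e2 : e + 1 + 2 = e by case: (I3_add3 e).
have e3 : e + 2 + 2 = e + 1 by apply/val_inj; case: (e) => [[|[|[|//]]] ?].
have e4 : e + 1 + 1 = e + 2 by apply/val_inj; case: (e) => [[|[|[|//]]] ?].
have e5 : e + 2 != e + 1 by case: (e) => [[|[|[|//]]] ?].
rewrite e1 e2 e3 e4 -[RHS](avg_in_cell2 u v e5) -avgD; congr (_ * _); apply: eq_avg => x.
rewrite -avgD; apply: eq_avg => y.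
rewrite [in_cell (e + 1) v x y * _]mulrC -mulrDl.
set w := in_cell _ _ _ _ * in_cell _ _ _ _.
have [->|w0] := eqVneq w 0; first by rewrite mulr0.
rewrite -[RHS]mul1r; congr (_ * _).
rewrite -(cov (e, x) (e, y)) /cover !(big_mkcond (fun r => _ == col r)) -big_split /=.
apply: eq_bigr => r _.
case Sx: (S r (e, x)); last by rewrite mul0r !if_same addr0.
case Ty: (T r (e, y)); last by rewrite mulr0 !if_same addr0.
rewrite mulr1; have := val r _ _ Sx Ty; case: (col r) => k j /=.
move=> /andP[/andP[ke xj] /andP[_ yj]].
move: w0; rewrite /w /in_cell -!natrM !mulnb pnatr_eq0 eqb0 negbK.
move=> /andP[/andP[ux uy] /andP[vx vy]].
have [k2|k2] := eqVneq k (e + 2).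
  rewrite k2 in xj yj *; rewrite (in_class_color ux uy xj yj) eqxx.
  by rewrite xpair_eqE eq_sym (negPf e5) addr0.
have k1 : k = e + 1.
  by apply: (@other_third _ _ true); rewrite /= /other ?e4 ?e2// eq_sym.
rewrite k1 in xj yj *; rewrite (in_class_color vx vy xj yj) eqxx.
by rewrite xpair_eqE (negPf e5) add0r.
Qed.

(* With [r = (2/3)^h] the argument allows the minimum of [r] and
   [1 - 2 r + 2 r^2], which differs from [r] only at [h = 1]. *)
Definition kappa (h : nat) : rat := if h == 1%N then 5 / 9 else (2 / 3) ^+ h.

Lemma kappa_bounds h : let r := (2 / 3) ^+ h in
  [/\ 0 <= kappa h, kappa h <= r <= 1 & kappa h <= 1 - 2 * r + 2 * r ^+ 2].
Proof.
rewrite /kappa; case: h => [|[|h]] /=; [by split; lra|by split; lra|].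
have r0 := twothirdsX_ge0 h.
have r1 := twothirdsX_le1 h.
(* Here [r <= 4/9], and [(1 - r) (1 - 2 r) >= 0] gives the last bound. *)
rewrite !exprS; split; [by lra|by lra|by nra].
Qed.

(** [Y e] is the share of the block omitting [e] that is coloured through child [e + 2]; its
    complement goes through [e + 1]. Each child thus compares shares of two blocks, and the three
    comparisons form the cycle of [xorr_cycle]. *)
Lemma sum_xorr_class_cover h (I : finType) (S T : I -> mterm h.+1 -> bool) col :
  tiling S T col ->
  kappa h * 6 ^+ h <=
  \sum_c \sum_u xorr (class_cover S T col c true u) (class_cover S T col c false u).
Proof.
move=> til; have [k0 kr kr2] := kappa_bounds h.
pose Y e u v := pair_cover S T col (e + 2) true u v.
have U0 : (0 < #|stype h|)%N by rewrite card_stype expn_gt0.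
have Y01 e u v : 0 <= Y e u v <= 1 by exact: pair_cover01.
have := sum_xorr_avg_ge U0 Y01; rewrite card_stype natrX => /(ler_wpM2l k0) /le_trans; apply.
rewrite mulr_sumr; apply: ler_sum => c _; rewrite mulr_sumr; apply: ler_sum => u _.
have Yt : avg (Y (c + 1) u) = avg (pair_cover S T col c true u).
  by apply: eq_avg => v; rewrite /Y; case: (I3_add3 c) => ->.
have Yf : avg (fun v => 1 - Y (c + 2) v u) = avg (pair_cover S T col c false u).
  apply: eq_avg => v; rewrite -(pair_cover_sum (c + 2) v u til) /Y addrAC subrr add0r.
  by case: (I3_add3 c) => _ ->.
have avg01 o : 0 <= avg (pair_cover S T col c o u) <= 1.
  rewrite avg_ge0 -?[leRHS](avg_cst 1 U0) ?le_avg// => v.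
    by case/andP: (pair_cover01 c o u v til).
  by case/andP: (pair_cover01 c o u v til).
by rewrite Yt Yf; apply: (xorr_squeeze_ge k0 kr kr2); rewrite ?avg01 ?class_cover_bounds.
Qed.

(** * The second-moment bound *)

Lemma sum_off_meas_cross h (I : finType) (S T : I -> mterm h.+1 -> bool) col :
  tiling S T col ->
  \sum_r \sum_c 2 * (off_meas (S r) (T r) c true * off_meas (S r) (T r) c false) <=
  3 * 9 ^+ h - kappa h * 6 ^+ h.
Proof.
move=> til; have [cov val] := til.
apply: le_trans (ler_sum _ (fun r _ => ler_sum _ (fun c _ => off_meas_cross c (val r)))) _.
under eq_bigr do rewrite sumrB; rewrite sumrB; apply: lerB.
  apply: le_trans (ler_sum _ (fun r _ => sum_diag_meas (S r) (T r) (col r))) _.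
  rewrite -mulr_sumr exchange_big /= (eq_bigr _ (fun e _ => sum_area e cov)).
  by rewrite sumr_const card_ord mulrC.
apply: le_trans (sum_xorr_class_cover til) _.
rewrite [leRHS]exchange_big; apply: ler_sum => c _.
rewrite (exchange_big_dep xpredT)//=; apply: ler_sum => u _.
(* The losses of the rectangles of one colour add up to at least the [xorr] of their total
   measures. *)
by apply: sum_xorr_ge => r; exact: diag_meas_ge0.
Qed.

Fixpoint waste (h : nat) : rat :=
  if h is h'.+1 then 6 * waste h' + kappa h' * 6 ^+ h' else 0.

Lemma sum_sing_meas_sqr h (I : finType) (S T : I -> mterm h -> bool) col :
  tiling S T col -> \sum_r sing_meas (S r) (T r) ^+ 2 <= 9 ^+ h - waste h.
Proof.
elim: h => [|h IH] in S T col *.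
  (* At height 0 each measure lies in [[0, 1]], so its square is at most itself, and the measures
     sum to 1. *)
  move=> [cov _]; rewrite subr0 (_ : 9 ^+ 0 = 6 ^+ 0)// -(sum_sing_meas cov); apply: ler_sum => r _.
  rewrite /sing_meas; set x := bigop _ _ _.
  have x01 : 0 <= x <= 1.
    rewrite /x (big_pred1 tt) => [|[]//].
    by rewrite mulr_ge0 ?class_meas_ge0//= mulr_ile1 ?class_meas_ge0 ?class_meas_le1.
  by rewrite expr2 ler_piMl; case/andP: x01.
move=> til; have [cov val] := til.
(* Only the child [(col r).1] contributes, so the square of the sum has a single cross term. *)
have sqE r : sing_meas (S r) (T r) ^+ 2 = \sum_c \sum_o off_meas (S r) (T r) c o ^+ 2 +
    \sum_c 2 * (off_meas (S r) (T r) c true * off_meas (S r) (T r) c false).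
  have off0 c o : c != (col r).1 -> off_meas (S r) (T r) c o = 0.
    move=> ci; rewrite (off_meas_color _ _ (val r)) big1// => u /eqP ui.
    by rewrite -ui eqxx in ci.
  rewrite sing_meas_succ -big_split /=.
  rewrite (bigD1 (col r).1)//= [in RHS](bigD1 (col r).1)//= [X in (_ + X) ^+ 2]big1 ?addr0.
  rewrite [X in _ = _ + X]big1 ?addr0.
  - by rewrite !big_bool /=; ring.
  - by move=> c ci; rewrite big1 ?off0 ?mul0r ?mulr0 ?addr0// => o _; rewrite off0// expr0n.
  - by move=> c ci; rewrite big1// => o _; rewrite off0.
under eq_bigr do rewrite sqE.
rewrite big_split /=; apply: le_trans (lerD _ (sum_off_meas_cross til)) _.
  rewrite exchange_big; apply: ler_sum => c _; rewrite exchange_big.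
  by apply: ler_sum => o _; exact: (sum_off_meas_sqr c o IH til).
rewrite !sumr_const card_ord card_bool !exprS /=; lra.
Qed.

(** * From formulas to tilings *)

(** Each leaf gives one rectangle. An AND gate splits the columns by the value of its left
    subformula there; an OR gate splits the rows likewise. *)
Lemma formula_tiles n (phi : mformula n) (X Y : finType)
    (x : X -> n.-tuple bool) (y : Y -> n.-tuple bool) (S : X -> bool) (T : Y -> bool) :
  (forall a, S a -> meval phi (x a)) -> (forall b, T b -> ~~ meval phi (y b)) ->
  exists (I : finType) (S' : I -> X -> bool) (T' : I -> Y -> bool) (c : I -> 'I_n),
  [/\ #|I| = msize phi,
      forall a b, \sum_r (S' r a)%:R * (T' r b)%:R = (S a)%:R * (T b)%:R :> rat &
      forall r a b, S' r a -> T' r b -> tnth (x a) (c r) && ~~ tnth (y b) (c r)].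
Proof.
elim: phi S T => [i|f IHf g IHg|f IHf g IHg] S T /= Sx Ty.
- exists unit, (fun=> S), (fun=> T), (fun=> i); split; first by rewrite card_unit.
    by move=> a b; rewrite (big_pred1 tt) // => -[].
  by move=> _ a b /Sx-> /Ty->.
- have [||I [S1 [T1 [c1 [n1 class_cover v1]]]]] := IHf S (fun b => T b && ~~ meval f (y b)).
  + by move=> a /Sx/andP[].
  + by move=> b /andP[].
  have [||J [S2 [T2 [c2 [n2 pair_cover v2]]]]] := IHg S (fun b => T b && meval f (y b)).
  + by move=> a /Sx/andP[].
  + by move=> b /andP[/Ty/[swap]->].
  exists (I + J)%type, (fun r => match r with inl r => S1 r | inr r => S2 r end),
    (fun r => match r with inl r => T1 r | inr r => T2 r end),
    (fun r => match r with inl r => c1 r | inr r => c2 r end).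
  split; [by rewrite card_sum n1 n2|move=> a b|by move=> [r|r]; [exact: v1|exact: v2]].
  rewrite big_sumType /= class_cover pair_cover -mulrDr; congr (_ * _).
  by case: (T b); case: (meval f (y b)).
- have [||I [S1 [T1 [c1 [n1 class_cover v1]]]]] := IHf (fun a => S a && meval f (x a)) T.
  + by move=> a /andP[].
  + by move=> b /Ty; rewrite negb_or => /andP[].
  have [||J [S2 [T2 [c2 [n2 pair_cover v2]]]]] := IHg (fun a => S a && ~~ meval f (x a)) T.
  + by move=> a /andP[/Sx/orP[->|]].
  + by move=> b /Ty; rewrite negb_or => /andP[].
  exists (I + J)%type, (fun r => match r with inl r => S1 r | inr r => S2 r end),
    (fun r => match r with inl r => T1 r | inr r => T2 r end),
    (fun r => match r with inl r => c1 r | inr r => c2 r end).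
  split; [by rewrite card_sum n1 n2|move=> a b|by move=> [r|r]; [exact: v1|exact: v2]].
  rewrite big_sumType /= class_cover pair_cover -mulrDl; congr (_ * _).
  by case: (S a); case: (meval f (x a)).
Qed.

(** * Inputs of the majority tree encoded by terms *)

(** The base-3 digits of an index, most significant first, are the path from the root to its
    leaf. *)
Fixpoint decode (h : nat) : 'I_(3 ^ h) -> color h :=
  match h with
  | 0 => fun _ => tt
  | h'.+1 => fun i => (inord (i %/ 3 ^ h'),
      decode (Ordinal (ltn_pmod i (expn_gt0 3 h' : (0 < 3 ^ h')%N))))
  end.

Lemma decode_block h (k : 'I_3) (j : 'I_(3 ^ h)) : @decode h.+1 (block_idx k j) = (k, decode j).
Proof.
rewrite /=; congr (_, _).
  by apply/val_inj; rewrite /= divnMDl ?expn_gt0// divn_small// addn0 inord_val.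
by congr decode; apply/val_inj; rewrite /= modnMDl modn_small.
Qed.

Definition minterm_input h (P : mterm h) : (3 ^ h).-tuple bool :=
  [tuple in_term P (decode i) | i < 3 ^ h].

Definition maxterm_input h (P : mterm h) : (3 ^ h).-tuple bool :=
  [tuple ~~ in_term P (decode i) | i < 3 ^ h].

Lemma block_minterm_input h (P : mterm h.+1) k :
  k != P.1 -> block k (minterm_input P) = minterm_input (P.2 k).
Proof.
move=> kP; apply: eq_from_tnth => j.
by rewrite !tnth_mktuple decode_block /= kP.
Qed.

Lemma block_maxterm_input h (P : mterm h.+1) k :
  k != P.1 -> block k (maxterm_input P) = maxterm_input (P.2 k).
Proof.
move=> kP; apply: eq_from_tnth => j.
by rewrite !tnth_mktuple decode_block /= kP.
Qed.

Lemma maj3_two (f : 'I_3 -> bool) (a : 'I_3) (b : bool) :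
  (forall k, k != a -> f k = b) -> maj3 (f (inord 0)) (f (inord 1)) (f (inord 2)) = b.
Proof.
have ne (i : nat) : (i < 3)%N -> i != a -> (inord i : 'I_3) != a.
  by move=> i3; rewrite -val_eqE /= inordK.
move=> fa; case: a ne fa => [[|[|[|//]]] a3] ne fa.
- by rewrite !(fa (inord 1), fa (inord 2)) ?ne//; case: b {fa}; case: (f _).
- by rewrite !(fa (inord 0), fa (inord 2)) ?ne//; case: b {fa}; case: (f _).
- by rewrite !(fa (inord 0), fa (inord 1)) ?ne//; case: b {fa}; case: (f _).
Qed.

Lemma BRecMAJ3_minterm h (P : mterm h) : BRecMAJ3 (minterm_input P) = true.
Proof.
elim: h P => [|h IH] P; first by rewrite /= tnth_mktuple.
by apply: (@maj3_two (fun k => BRecMAJ3 (block k (minterm_input P))) P.1) => k kP;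
  rewrite block_minterm_input.
Qed.

Lemma BRecMAJ3_maxterm h (P : mterm h) : BRecMAJ3 (maxterm_input P) = false.
Proof.
elim: h P => [|h IH] P; first by rewrite /= tnth_mktuple.
by apply: (@maj3_two (fun k => BRecMAJ3 (block k (maxterm_input P))) P.1) => k kP;
  rewrite block_maxterm_input.
Qed.

Fixpoint relabel m n (s : 'I_m -> 'I_n) (phi : mformula m) : mformula n :=
  match phi with
  | MVar i => MVar (s i)
  | MAnd f g => MAnd (relabel s f) (relabel s g)
  | MOr f g => MOr (relabel s f) (relabel s g)
  end.

Lemma meval_relabel m n (s : 'I_m -> 'I_n) phi x :
  meval (relabel s phi) x = meval phi [tuple tnth x (s i) | i < m].
Proof.
by elim: phi => [i|f IHf g IHg|f IHf g IHg] /=; rewrite ?tnth_mktuple ?IHf ?IHg.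
Qed.

(** Excludes the junk value 0 of [Lm], so that a minimal formula exists. *)
Lemma BRecMAJ3_formula h : exists phi, computes phi (@BRecMAJ3 h).
Proof.
elim: h => [|h [phi phiP]]; first by exists (MVar ord0).
pose f k := relabel (@block_idx h (inord k)) phi.
exists (MOr (MAnd (f 0%N) (f 1%N)) (MAnd (MOr (f 0%N) (f 1%N)) (f 2%N))) => x /=.
have fE k : meval (f k) x = BRecMAJ3 (block (inord k) x).
  by rewrite /f meval_relabel phiP.
by rewrite !fE; do 3 case: (BRecMAJ3 _).
Qed.

(** * Size bound and numerical estimates *)

Lemma msize_lower h (phi : mformula (3 ^ h)) : computes phi (@BRecMAJ3 h) ->
  36 ^+ h <= (msize phi)%:R * (9 ^+ h - waste h).
Proof.
move=> phiP.
have [||I [S [T [c [<- cov val]]]]] :=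
    @formula_tiles _ phi _ _ (@minterm_input h) (@maxterm_input h) xpredT xpredT.
- by move=> P _; rewrite phiP BRecMAJ3_minterm.
- by move=> P _; rewrite phiP BRecMAJ3_maxterm.
have til : tiling S T (fun r => decode (c r)).
  split=> [P Q|r P Q Sr Tr]; first by rewrite cov mulr1.
  by have := val r P Q Sr Tr; rewrite !tnth_mktuple negbK.
(* Cauchy-Schwarz over the rectangles, in averaged form. *)
have := sqr_avg (fun r => sing_meas (S r) (T r)).
have [I0|I0] := posnP #|I|.
  have /(congr1 (fun z => z == 0)) := sum_sing_meas (proj1 til).
  by rewrite big1 ?eqxx ?expf_eq0 ?andbF// => r; have := fintype0 r I0.
have m0 : 0 < #|I|%:R :> rat by rewrite ltr0n.
rewrite /avg (sum_sing_meas (proj1 til)) expr_div_n -exprM mulnC exprM.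
have -> : 6 ^+ 2 = 36 :> rat by [].
rewrite ler_pdivrMr ?exprn_gt0// => /le_trans; apply.
have -> : forall z : rat, z / #|I|%:R * #|I|%:R ^+ 2 = #|I|%:R * z.
  by move=> z; rewrite expr2 mulrA divfK ?gt_eqF// mulrC.
by rewrite ler_wpM2l ?ler0n// (sum_sing_meas_sqr til).
Qed.

(** The constant is [waste 4]; afterwards the [kappa] terms are dropped. *)
Lemma waste_ge k : 496 * 6 ^+ k <= waste (4 + k).
Proof.
elim: k => [|k IH]; first by rewrite /= /kappa /=; lra.
rewrite addnS exprS -[waste _]/(6 * waste (4 + k) + kappa (4 + k) * 6 ^+ (4 + k)).
have [k0 _ _] := kappa_bounds (4 + k).
have := mulr_ge0 k0 (natrX_ge0 6 (4 + k)).
by move: (waste _) (6 ^+ k) (kappa _ * _) IH {k0} => w s p IH p0; lra.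
Qed.

Lemma exprM_eq (a b c : rat) n : c = a * b -> c ^+ n = a ^+ n * b ^+ n.
Proof. by move=> ->; rewrite exprMn. Qed.

(** With [t = 31/81 r] the hypotheses give [a <= M (1 - t)]; multiplying by [1 + t] yields
    [a (1 + t) <= M], and [31/81 >= 13/36]. Here [31/81] is [496/1296], that is [waste 4 / 6^4]. *)
Lemma ge_of_waste (F : realFieldType) (M a r w q : F) :
  0 <= M -> 0 <= a -> 0 <= r -> r <= 1 -> 0 < q ->
  31 / 81 * (r * q) <= w -> a * q <= M * (q - w) -> a + 13 / 36 * (a * r) <= M.
Proof.
move=> M0 a0 r0 r1 q0 wr aM.
have {}aM : a <= M * (1 - 31 / 81 * r).
  rewrite -(ler_pM2r q0); apply: le_trans aM _.
  by rewrite -[leRHS]mulrA ler_wpM2l//; lra.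
have ar0 := mulr_ge0 a0 r0.
apply: (@le_trans _ _ (a * (1 + 31 / 81 * r))); first by lra.
apply: (@le_trans _ _ (M * (1 - 31 / 81 * r) * (1 + 31 / 81 * r))).
  by rewrite ler_wpM2r//; lra.
by rewrite -[leLHS]mulrA ler_piMr//; have := mulr_ge0 r0 r0; lra.
Qed.

Lemma numeric_bound h (M : nat) : (2 <= h)%N ->
  36 ^+ h <= M%:R * (9 ^+ h - waste h) ->
  4 ^+ h + 13 / 36 * (8 / 3) ^+ h <= M%:R :> rat.
Proof.
have e8 : 8 / 3 = 4 * (2 / 3) :> rat by lra.
have e6 : 6 = 2 / 3 * 9 :> rat by lra.
have e36 : 36 = 4 * 9 :> rat by lra.
have e1296 : 6 ^+ 4 = 1296 :> rat by lra.
case: h => [/notF[]|[/notF[]|[|[|h]]]] _ MW.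
- rewrite (_ : waste 2 = 28 / 3) in MW; last by [].
  (* The hypothesis gives only [M >= 3888/215], just above 18, while the goal needs about 18.57;
     integrality lifts [M] to 19. *)
  have : (18 < M)%N by rewrite -(ltr_nat rat); lra.
  by rewrite -(ler_nat rat); lra.
- by rewrite (_ : waste 3 = 72) in MW; [lra|].
rewrite -[h.+4]/(4 + h)%N in MW *; set n := (4 + h)%N in MW *.
rewrite (exprM_eq n e8).
apply: (@ge_of_waste _ _ _ _ (waste n) (9 ^+ n)).
- exact: ler0n.
- exact: natrX_ge0.
- exact: twothirdsX_ge0.
- exact: twothirdsX_le1.
- by apply: exprn_gt0; rewrite ltr0n.
- apply: le_trans (waste_ge h).
  rewrite -(exprM_eq n e6) exprD e1296; move: (natrX_ge0 6 h) => s0.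
  by move: (6 ^+ h) s0 {MW} => s s0; lra.
- by rewrite -(exprM_eq n e36).
Qed.

Theorem theorem6p2 (h : nat) (h_ge2 : (2 <= h)%N) :
  4 ^+ h + 13 / 36 * (8 / 3) ^+ h <= (Lm (@BRecMAJ3 h))%:R :> rat.
Proof.
have [phi0 phi0P] := BRecMAJ3_formula h.
have [[phi [phiP <-]] _] := Lm_min phi0P.
exact: numeric_bound h_ge2 (msize_lower phiP).
Qed.
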